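(* Dynamic Graph Coloring (as defined in the context) is fixed-parameter tractable with respect to the edit-parameter $k$. That is, there is an algorithm that, given an instance $(G,G',C,k,r)$ of Dynamic Graph Coloring, decides it in time $f(k)\cdot |I|^{O(1)}$ for some computable function $f$, where $|I|$ is the size of the instance.
   Context: All graphs are simple and undirected. A $c$-coloring of a graph $G=(V,E)$ is a map $C:V\to\{1,\dots,c\}$ with $C(u)\neq C(v)$ for every edge $uv\in E$. For graphs $G=(V,E)$ and $G'=(V,E')$ on the same vertex set, the edit-distance $d_e(G,G')$ is the number of edge modifications (edge additions and deletions) needed to transform $G$ into $G'$. For two colorings $C,C'$ of the same vertex set, the Hamming distance $d(C,C')$ is the number of vertices $v$ with $C(v)\neq C'(v)$. Dynamic Graph Coloring (DGC): Input is a quintuple $(G,G',C,k,r)$ where $G=(V,E)$ is a graph with a $c$-coloring $C$, $G'=(V,E')$ is a graph with $d_e(G,G')\le k$, and $r$ is a nonnegative integer (the increment-parameter). Question: does there exist a $(c+r)$-coloring $C'$ of $G'$, where the sought coloring $C'$ is obtained from $C$ by at most $r$ re-coloring operations (i.e. $d(C,C')\le r$)? The edit-parameter is $k$. *)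

(* Defs.v *)
From mathcomp Require Import all_boot.

Set Implicit Arguments.
Unset Strict Implicit.
Unset Printing Implicit Defensive.

(* Random access machines with addition, subtraction and halving, under the
   uniform cost measure (polynomially equivalent to Turing machines).  There is
   deliberately no multiplication, so that in t steps register contents grow by
   at most O(t) bits.  Registers hold natural numbers; [Minus] is truncated. *)

Inductive instr : Type :=
| Const of nat & nat          (* Const i a   : R_i := a             *)
| Plus of nat & nat & nat     (* Plus i j l  : R_i := R_j + R_l     *)
| Minus of nat & nat & nat    (* Minus i j l : R_i := R_j - R_l     *)
| Half of nat & nat           (* Half i j    : R_i := floor (R_j/2) *)
| Fetch of nat & nat          (* Fetch i j   : R_i := R_(R_j)       *)
| Store of nat & nat          (* Store i j   : R_(R_i) := R_j       *)
| Jump of nat                 (* Jump q      : goto q               *)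
| JumpZero of nat & nat.      (* JumpZero i q: if R_i = 0 goto q    *)

Definition program := seq instr.
Definition memory := nat -> nat.

Record config := Config { pc : nat; regs : memory }.

Definition update (m : memory) (i a : nat) : memory :=
  fun j => if j == i then a else m j.

Definition exec (a : instr) (s : config) : config :=
  let q := pc s in
  let m := regs s in
  match a with
  | Const i b => Config q.+1 (update m i b)
  | Plus i j l => Config q.+1 (update m i (m j + m l))
  | Minus i j l => Config q.+1 (update m i (m j - m l))
  | Half i j => Config q.+1 (update m i (m j)./2)
  | Fetch i j => Config q.+1 (update m i (m (m j)))
  | Store i j => Config q.+1 (update m (m i) (m j))
  | Jump q' => Config q' m
  | JumpZero i q' => Config (if m i == 0 then q' else q.+1) m
  end.

(* The machine has halted when the program counter is outside the program;
   a halted configuration is a fixed point of [step]. *)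
Definition step (M : program) (s : config) : config :=
  if onth M (pc s) is Some a then exec a s else s.

(* Input x_1, ..., x_l: R_0 = l, R_i = x_i for 1 <= i <= l, and 0 elsewhere. *)
Definition init (x : seq nat) : config := Config 0 (nth 0 (size x :: x)).

(* On input x, M halts after at most t steps with output y in R_0. *)
Definition outputs_within (M : program) (x : seq nat) (t y : nat) : Prop :=
  let s := iter t (step M) (init x) in size M <= pc s /\ regs s 0 = y.

Definition computable (f : nat -> nat) : Prop :=
  exists M : program, forall a : nat, exists t : nat,
    outputs_within M [:: a] t (f a).

(* Length of the binary representation; bitlen 0 = 1. *)
Definition bitlen (a : nat) : nat := (trunc_log 2 a).+1.

Definition input_size (x : seq nat) : nat := \sum_(a <- x) bitlen a.

Record param_problem := ParamProblem {
  instance : Type;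
  encode : instance -> seq nat;
  param : instance -> nat;
  yes_instance : instance -> Prop
}.

(* Since input_size is positive on nonempty inputs, constant factors of the
   polynomial are absorbed by f. *)
Definition fixed_parameter_tractable (P : param_problem) : Prop :=
  exists (f : nat -> nat) (M : program) (d : nat),
    computable f /\
    forall I : instance P, exists b : bool,
      (b <-> yes_instance I) /\
      outputs_within M (encode I)
        (f (param I) * input_size (encode I) ^ d) b.

Record sgraph (n : nat) := SGraph {
  adj : rel 'I_n;
  adj_sym : symmetric adj;
  adj_irr : irreflexive adj
}.

Definition edges (n : nat) (G : sgraph n) : {set {set 'I_n}} :=
  [set e | [exists u, exists v, adj G u v && (e == [set u; v])]].

(* Number of edge deletions plus number of edge additions. *)
Definition edit_distance (n : nat) (G G' : sgraph n) : nat :=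
  #|edges G :\: edges G'| + #|edges G' :\: edges G|.

Definition is_coloring (n : nat) (G : sgraph n) (c : nat) (C : 'I_n -> nat)
    : Prop :=
  (forall v, 1 <= C v <= c) /\ (forall u v, adj G u v -> C u != C v).

Definition hamming (n : nat) (C C' : 'I_n -> nat) : nat :=
  #|[set v | C v != C' v]|.

Record dgc_instance := DGCInstance {
  nvertices : nat;
  graph : sgraph nvertices;
  graph' : sgraph nvertices;
  ncolors : nat;
  col : 'I_nvertices -> nat;
  edit : nat;
  incr : nat;
  col_ok : is_coloring graph ncolors col;
  edit_ok : edit_distance graph graph' <= edit
}.

Definition adj_matrix (n : nat) (G : sgraph n) : seq nat :=
  [seq nat_of_bool (adj G u v) | u <- enum 'I_n, v <- enum 'I_n].

Definition dgc_encode (I : dgc_instance) : seq nat :=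
  [:: nvertices I; ncolors I; edit I; incr I]
    ++ [seq col v | v <- enum 'I_(nvertices I)]
    ++ adj_matrix (graph I) ++ adj_matrix (graph' I).

Definition dgc_yes (I : dgc_instance) : Prop :=
  exists C' : 'I_(nvertices I) -> nat,
    is_coloring (graph' I) (ncolors I + incr I) C' /\
    hamming (@col I) C' <= incr I.

Definition DGC_by_edit : param_problem :=
  @ParamProblem dgc_instance dgc_encode edit dgc_yes.

(* Main.v *)
Require Import Defs.
From mathcomp Require Import all_boot zify.

Set Implicit Arguments.
Unset Strict Implicit.
Unset Printing Implicit Defensive.

(* Call an edge of G' conflicting if C gives its ends the same color.  The
   recolored vertices of a solution cover all conflicting edges; conversely, a
   vertex cover of size at most r can be recolored with pairwise distinct fresh
   colors among c + 1, ..., c + r.  So the question is whether the conflicting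
   edges have a vertex cover of size at most r.  Conflicting edges are not in
   G, so there are at most k of them, hence at most 2k conflicting ordered
   pairs.  The machine runs through all y < 2^(2k); the bits of y choose an end
   of each conflicting pair, and the distinct chosen vertices are counted. *)

(** * A structured language over the machine *)

(** Tests ask whether a register is nonzero: [Loop i c] repeats [c] while it is, and [Cond i c1 c2]
    then takes [c1]. *)
Inductive cmd : Type :=
| Skip
| Basic of instr
| Seq of cmd & cmd
| Loop of nat & cmd
| Cond of nat & cmd & cmd.

(** Jump targets are absolute, so [q] is the address at which the code will be placed. *)
Fixpoint compile (q : nat) (c : cmd) : program :=
  match c with
  | Skip => [::]
  | Basic a => [:: a]
  | Seq c1 c2 =>
      compile q c1 ++ compile (q + size (compile q c1)) c2
  | Loop i c1 =>
      let p := compile q.+1 c1 in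
      JumpZero i (q + size p).+2 :: p ++ [:: Jump q]
  | Cond i c1 c2 =>
      let p1 := compile q.+1 c1 in
      let p2 := compile (q + size p1).+2 c2 in
      JumpZero i (q + size p1).+2
        :: p1 ++ Jump (q + size p1 + size p2).+2 :: p2
  end.

(* [run_basic] excludes the jumps: its premise says that [a] moves on to the
   next instruction wherever it is placed. *)
Inductive run : cmd -> memory -> nat -> memory -> Prop :=
| run_skip m : run Skip m 0 m
| run_basic a m m' :
    (forall q, exec a (Config q m) = Config q.+1 m') -> run (Basic a) m 1 m'
| run_seq c1 c2 m1 m2 m3 t1 t2 :
    run c1 m1 t1 m2 -> run c2 m2 t2 m3 -> run (Seq c1 c2) m1 (t1 + t2) m3
| run_loop_exit i c m : m i = 0 -> run (Loop i c) m 1 m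
| run_loop_next i c m1 m2 m3 t1 t2 :
    m1 i <> 0 -> run c m1 t1 m2 -> run (Loop i c) m2 t2 m3 ->
    run (Loop i c) m1 (1 + t1 + (1 + t2)) m3
| run_cond_zero i c1 c2 m m' t :
    m i = 0 -> run c2 m t m' -> run (Cond i c1 c2) m (1 + t) m'
| run_cond_nonzero i c1 c2 m m' t :
    m i <> 0 -> run c1 m t m' -> run (Cond i c1 c2) m (1 + t + 1) m'.

Definition code_at (M : program) (q : nat) (p : program) : Prop :=
  forall j a, onth p j = Some a -> onth M (q + j) = Some a.

Lemma code_at_cat M q p1 p2 :
  code_at M q (p1 ++ p2) -> code_at M q p1 /\ code_at M (q + size p1) p2.
Proof.
move=> Mp; split=> j a pj.
  apply: Mp; rewrite onth_cat.
  by have := onthTE p1 j; rewrite pj /= => <-.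
by rewrite -addnA; apply: Mp; rewrite onth_cat ltnNge leq_addr /= addKn.
Qed.

Lemma code_at_cons M q a p :
  code_at M q (a :: p) -> onth M q = Some a /\ code_at M q.+1 p.
Proof.
move=> /(@code_at_cat _ _ [:: a])[Ma]; rewrite addn1; split=> //.
by rewrite -[q]addn0; apply: Ma.
Qed.

Lemma iter_trans (T : Type) (f : T -> T) t1 t2 x y z :
  iter t1 f x = y -> iter t2 f y = z -> iter (t1 + t2) f x = z.
Proof. by move=> <- <-; rewrite addnC iterD. Qed.

Lemma step_at M q m a : onth M q = Some a ->
  iter 1 (step M) (Config q m) = exec a (Config q m).
Proof. by rewrite /= /step /= => ->. Qed.

Lemma iter_run M c m t m' : run c m t m' ->
  forall q, code_at M q (compile q c) ->
  iter t (step M) (Config q m) = Config (q + size (compile q c)) m'.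
Proof.
elim=> {c m t m'}.
- by move=> m q _; rewrite addn0.
- by move=> a m m' am q /code_at_cons[/step_at-> _]; rewrite am addn1.
- move=> c1 c2 m1 m2 m3 t1 t2 _ IH1 _ IH2 q /code_at_cat[/IH1 E1 /IH2 E2].
  by rewrite /= size_cat addnA; apply: iter_trans E1 E2.
- move=> i c m mi q /code_at_cons[/step_at-> _] /=; rewrite mi eqxx.
  by rewrite size_cat /= addn1 !addnS.
- move=> i c m1 m2 m3 t1 t2 m1i _ IH1 _ IH2 q Mq.
  have /code_at_cons[Mq0 /code_at_cat[/IH1 E1 /code_at_cons[Mq2 _]]] := Mq.
  (* The backward jump returns to address [q], so the hypothesis for the remaining iterations
     applies to the same code. *)
  apply: iter_trans (iter_trans (step_at _ Mq2) (IH2 _ Mq)).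
  by apply: iter_trans (step_at _ Mq0) _ => /=; case: eqP.
- move=> i c1 c2 m m' t mi _ IH q /=.
  case/code_at_cons=> Mq0 /code_at_cat[_ /code_at_cons[_]].
  rewrite addSn => /IH E.
  apply: iter_trans (step_at _ Mq0) _; rewrite /= mi eqxx E.
  by rewrite size_cat /= !addnS !addSn addnA.
move=> i c1 c2 m m' t mi _ IH q /=.
case/code_at_cons=> Mq0 /code_at_cat[/IH E /code_at_cons[Mq1 _]].
apply: (iter_trans (iter_trans (step_at _ Mq0) _)).
  have -> : exec (JumpZero i (q + size (compile q.+1 c1)).+2) (Config q m) =
      Config q.+1 m by rewrite /=; case: eqP.
  exact: E.
by rewrite (step_at _ Mq1) /= size_cat /= !addnS addnA.
Qed.

Lemma iter_halted M t s : size M <= pc s -> iter t (step M) s = s.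
Proof.
move=> halted; elim: t => //= t ->.
by rewrite /step onth_default.
Qed.

(** A run ends with the program counter at the length of the code, where the machine is halted;
    hence any larger time bound gives the same output. *)
Lemma run_outputs c x t m t' : run c (nth 0 (size x :: x)) t m -> t <= t' ->
  outputs_within (compile 0 c) x t' (m 0).
Proof.
move=> cxm tt'; rewrite /outputs_within /init -(subnK tt') iterD.
rewrite (iter_run cxm) // add0n.
by rewrite iter_halted.
Qed.

(** * Symbolic execution *)

(* The first 20 cells serve as registers and are tracked by an explicit list
   [rs], so that reads and writes of registers compute; the others, accessed
   only through [Fetch] and [Store], are described by [h]. *)
Definition view (rs : seq nat) (h m : memory) : Prop :=
  size rs = 20 /\ forall a, m a = if a < 20 then nth 0 rs a else h a.

(** A Hoare triple for total correctness with a time bound. The postcondition speaks of the symbolic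
    state only, so that the rules below compose without mentioning memories. *)
Definition texec (c : cmd) (rs : seq nat) (h : memory) (t : nat)
    (Q : seq nat -> memory -> Prop) : Prop :=
  forall m, view rs h m -> exists t' m' rs' h',
    [/\ t' <= t, run c m t' m', view rs' h' m' & Q rs' h'].

Lemma texec_weaken c rs h t t' (Q Q' : seq nat -> memory -> Prop) :
  texec c rs h t Q -> t <= t' -> (forall rs h, Q rs h -> Q' rs h) ->
  texec c rs h t' Q'.
Proof.
move=> cQ tt' QQ' m /cQ[u [m' [rs' [h' [ut run_m v q]]]]].
by exists u, m', rs', h'; split=> //; [exact: leq_trans ut tt' | exact: QQ'].
Qed.

Lemma texec_skip rs h (Q : seq nat -> memory -> Prop) :
  Q rs h -> texec Skip rs h 0 Q.
Proof. by move=> q m v; exists 0, m, rs, h; split=> //; apply: run_skip. Qed.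

Lemma texec_seq c1 c2 rs h t1 t2 Q R :
  texec c1 rs h t1 R -> (forall rs h, R rs h -> texec c2 rs h t2 Q) ->
  texec (Seq c1 c2) rs h (t1 + t2) Q.
Proof.
move=> E1 E2 m /E1[u1 [m1 [rs1 [h1 [u1t run1 v1 /E2 q1]]]]].
have [u2 [m2 [rs2 [h2 [u2t run2 v2 q2]]]]] := q1 _ v1.
exists (u1 + u2), m2, rs2, h2; split=> //; first exact: leq_add.
exact: run_seq run1 run2.
Qed.

(** The extra [2] pays for the test and, after the first branch, for the jump over the second
    one. *)
Lemma texec_cond i c1 c2 rs h t Q : i < 20 ->
  (nth 0 rs i <> 0 -> texec c1 rs h t Q) ->
  (nth 0 rs i = 0 -> texec c2 rs h t Q) ->
  texec (Cond i c1 c2) rs h (t + 2) Q.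
Proof.
move=> i20 E1 E2 m v; have mi : m i = nth 0 rs i by rewrite v.2 i20.
case: (eqVneq (nth 0 rs i) 0) => [z|/eqP nz].
  have [u [m' [rs' [h' [ut run' v' q]]]]] := E2 z _ v.
  exists (1 + u), m', rs', h'; split=> //; first lia.
  by apply: run_cond_zero; rewrite ?mi.
have [u [m' [rs' [h' [ut run' v' q]]]]] := E1 nz _ v.
exists (1 + u + 1), m', rs', h'; split=> //; first lia.
by apply: run_cond_nonzero; rewrite ?mi.
Qed.

Lemma texec_loop i c t (Inv : nat -> seq nat -> memory -> Prop) N rs h :
  i < 20 ->
  (forall j rs h, j < N -> Inv j rs h ->
     nth 0 rs i <> 0 /\ texec c rs h t (Inv j.+1)) ->
  (forall rs h, Inv N rs h -> nth 0 rs i = 0) ->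
  Inv 0 rs h -> texec (Loop i c) rs h (N * (t + 2) + 1) (Inv N).
Proof.
move=> i20 body exit inv0.
(* Induction on the number [j] of iterations left, at which point the invariant has index
   [N - j]. *)
suff E j : j <= N -> forall rs h, Inv (N - j) rs h ->
    texec (Loop i c) rs h (j * (t + 2) + 1) (Inv N).
  by apply: E; rewrite ?subnn.
elim: j => [|j IH] jN {inv0}rs {}h.
  rewrite subn0 => inv m v; exists 1, m, rs, h; split=> //.
  by apply: run_loop_exit; rewrite v.2 i20; apply: exit inv.
move=> inv m v; have jN' : N - j.+1 < N by lia.
have [nz E1] := body _ _ _ jN' inv.
have [u1 [m1 [rs1 [h1 [u1t run1 v1]]]]] := E1 _ v.
rewrite subnSK // => /IH E2.
have [u2 [m2 [rs2 [h2 [u2t run2 v2 q]]]]] := E2 (ltnW jN) _ v1.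
exists (1 + u1 + (1 + u2)), m2, rs2, h2; split=> //; first lia.
by apply: run_loop_next run1 run2; rewrite v.2 i20.
Qed.

Definition sexec (a : instr) (s : seq nat * memory) : seq nat * memory :=
  let: (rs, h) := s in
  match a with
  | Const i b => (set_nth 0 rs i b, h)
  | Plus i j l => (set_nth 0 rs i (nth 0 rs j + nth 0 rs l), h)
  | Minus i j l => (set_nth 0 rs i (nth 0 rs j - nth 0 rs l), h)
  | Half i j => (set_nth 0 rs i (nth 0 rs j)./2, h)
  | Fetch i j => (set_nth 0 rs i (h (nth 0 rs j)), h)
  | Store i j => (rs, update h (nth 0 rs i) (nth 0 rs j))
  | _ => s
  end.

(** Indirect accesses must hit cells from 20 on, so that they cannot alias a register; jumps are
    rejected. *)
Definition safe (a : instr) (rs : seq nat) : bool :=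
  match a with
  | Const i _ => i < 20
  | Plus i j l | Minus i j l => [&& i < 20, j < 20 & l < 20]
  | Half i j => (i < 20) && (j < 20)
  | Fetch i j => [&& i < 20, j < 20 & 20 <= nth 0 rs j]
  | Store i j => [&& i < 20, j < 20 & 20 <= nth 0 rs i]
  | _ => false
  end.

Fixpoint block (l : seq instr) (c : cmd) : cmd :=
  if l is a :: l' then Seq (Basic a) (block l' c) else c.

Fixpoint safe_block (l : seq instr) (s : seq nat * memory) : bool :=
  if l is a :: l' then safe a s.1 && safe_block l' (sexec a s) else true.

Lemma view_set rs h m i b : view rs h m -> i < 20 ->
  view (set_nth 0 rs i b) h (update m i b).
Proof.
move=> [s20 mE] i20; split=> [|a]; first by rewrite size_set_nth s20; lia.
rewrite /update nth_set_nth /= mE; case: eqP => [->|//].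
by rewrite i20.
Qed.

Lemma texec_basic a rs h : safe a rs ->
  texec (Basic a) rs h 1 (fun rs' h' => (rs', h') = sexec a (rs, h)).
Proof.
move=> sa m v; have mE i : i < 20 -> m i = nth 0 rs i by move=> i20; rewrite v.2 i20.
have mF i : 20 <= i -> m i = h i by move=> i20; rewrite v.2 ltnNge i20.
case: a sa => //=.
- move=> i b i20; exists 1, (update m i b), (set_nth 0 rs i b), h.
  by split=> //; [apply: run_basic | apply: view_set].
- move=> i j l /and3P[i20 j20 l20]; set b := nth 0 rs j + _.
  exists 1, (update m i b), (set_nth 0 rs i b), h.
  by split=> //; [apply: run_basic; rewrite /= !mE | apply: view_set].
- move=> i j l /and3P[i20 j20 l20]; set b := nth 0 rs j - _.
  exists 1, (update m i b), (set_nth 0 rs i b), h.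
  by split=> //; [apply: run_basic; rewrite /= !mE | apply: view_set].
- move=> i j /andP[i20 j20]; set b := _./2.
  exists 1, (update m i b), (set_nth 0 rs i b), h.
  by split=> //; [apply: run_basic; rewrite /= !mE | apply: view_set].
- move=> i j /and3P[i20 j20 rj]; set b := h _.
  exists 1, (update m i b), (set_nth 0 rs i b), h.
  by split=> //; [apply: run_basic; rewrite /= (mE j) // mF | apply: view_set].
move=> i j /and3P[i20 j20 ri].
exists 1, (update m (nth 0 rs i) (nth 0 rs j)), rs, (update h (nth 0 rs i) (nth 0 rs j)).
split=> //; first by apply: run_basic; rewrite /= !mE.
split=> [|b]; first exact: v.1.
rewrite /update; case: eqP => [->|_]; last exact: v.2.
by rewrite ltnNge ri.
Qed.

Arguments block : simpl never.

(** Straight-line code is run by computation: simplifying the [foldl] yields the state from which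
    [c] starts, and safety is a boolean side condition. *)
Lemma texec_block t l c rs h t' Q :
  safe_block l (rs, h) ->
  (let s := foldl (fun s a => sexec a s) (rs, h) l in texec c s.1 s.2 t Q) ->
  size l + t <= t' -> texec (block l c) rs h t' Q.
Proof.
move=> sl E le_t; apply: texec_weaken le_t (fun _ _ q => q).
elim: l rs h sl E => [|a l IH] rs h //= /andP[sa sl] E.
rewrite addSn -add1n; apply: texec_seq (texec_basic sa) _ => rs1 h1 rsE.
by apply: IH; rewrite rsE.
Qed.

Lemma view_id (m : memory) : view (mkseq m 20) m m.
Proof.
split=> [|a]; first by rewrite size_mkseq.
by case: ltnP => // a20; rewrite nth_mkseq.
Qed.

(** Starting from [2 ^ e], register 0 is doubled twice for each unit of the input, which register 1
    counts down. *)
Lemma computable_exp2 e : computable (fun k => 2 ^ (k + k + e)).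
Proof.
pose c := block [:: Const 0 (2 ^ e); Const 2 1]
  (Loop 1 (block [:: Plus 0 0 0; Plus 0 0 0; Minus 1 1 2] Skip)).
exists (compile 0 c) => k; exists (2 + (k * (3 + 2) + 1)).
pose Inv (j : nat) (rs : seq nat) (h : memory) := exists z,
  rs = [:: 2 ^ (j + j + e), k - j, 1 & z].
have E : texec c (mkseq (nth 0 [:: 1; k]) 20) (nth 0 [:: 1; k])
    (2 + (k * (3 + 2) + 1)) (Inv k).
  apply: (texec_block (t := k * (3 + 2) + 1)) => //=; apply: texec_loop => //=.
  - move=> j _ h jk [z ->]; split=> /=; first lia.
    apply: (texec_block (t := 0)) => //=; apply: texec_skip.
    by exists z; rewrite addSn addnS !addSn !expnS subn1 subnS; congr [:: _, _ & _]; lia.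
  - by move=> _ h [z ->]; rewrite /= subnn.
  - by exists (nseq 17 0); rewrite subn0.
have [t [m [rs [h [tle crun v [z rsE]]]]]] := E _ (view_id _).
have <- : m 0 = 2 ^ (k + k + e) by rewrite v.2 rsE.
exact: (@run_outputs _ [:: k] _ _ _ crun tle).
Qed.

(** * Covers chosen by a bit mask *)

Section Scan.

Variables (edge : pred nat) (src tgt : nat -> nat).

(* Each edge in turn consumes the lowest bit of the mask [s.1]. *)
Definition scan_step (s : nat * seq nat) (q : nat) : nat * seq nat :=
  if edge q then
    let w := if odd s.1 then src q else tgt q in
    (s.1./2, if w \in s.2 then s.2 else w :: s.2)
  else s.

Definition scan (y : nat) (qs : seq nat) : seq nat :=
  (foldl scan_step (y, [::]) qs).2.

Lemma scan_uniq y qs : uniq (scan y qs).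
Proof.
rewrite /scan; elim/last_ind: qs => // qs q IH; rewrite foldl_rcons.
rewrite {1}/scan_step; case: ifP => //= _; case: ifP => //= ->.
by rewrite IH.
Qed.

(** Whatever bit is read, one end of a scanned edge is in the list afterwards, and nothing ever
    leaves the list. *)
Lemma scan_covers y qs q : q \in qs -> edge q ->
  (src q \in scan y qs) || (tgt q \in scan y qs).
Proof.
rewrite /scan; elim/last_ind: qs => // qs q' IH; rewrite foldl_rcons mem_rcons.
move: (foldl _ _ qs) IH => [z A] /= IH; rewrite inE => /orP[/eqP <- eq|/IH{}IH].
  rewrite /scan_step eq /=; case: (odd _); case: ifP => /= w_in;
  by rewrite ?w_in ?inE ?eqxx ?orbT.
move=> /IH; rewrite /scan_step; case: (edge q') => //=.
by case: ifP => // _ /orP[]; rewrite !inE => ->; rewrite !orbT.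
Qed.

(** For a cover [S], each bit of the mask can be set to select an end lying in [S]; one bit per edge
    suffices. *)
Lemma scan_complete (S : pred nat) qs :
  {in qs, forall q, edge q -> S (src q) || S (tgt q)} ->
  exists2 y, y < 2 ^ count edge qs & all S (scan y qs).
Proof.
(* The induction runs over all starting lists contained in [S]; the empty list is the case at
   hand. *)
rewrite /scan => cov; have: all S [::] by [].
elim: qs [::] cov => [|q qs IH] A cov SA /=; first by exists 0.
have {}IH B : all S B -> _ := IH B (fun p pq => cov p (mem_behead (s := q :: qs) pq)).
rewrite /scan_step /= -/scan_step; case eq: (edge q) => /=; last exact: IH.
have [b Sb] : exists b : bool, S (if b then src q else tgt q).
  by have /orP[] := cov q (mem_head _ _) eq; [exists true | exists false].
set w := if b then _ else _ in Sb.
have [y yle Sy] := IH (if w \in A then A else w :: A) ltac:(by case: ifP; rewrite //= Sb).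
(* The bit of the first edge is the lowest one, since the scan reads masks from the low end. *)
exists (b + y.*2); first by rewrite expnD expn1; case: (b) => /=; lia.
by rewrite halfD oddD odd_double addbF; case: (b) @w Sb Sy => w Sb Sy /=;
   rewrite doubleK ?andbF.
Qed.

End Scan.

(** * The program *)

(* The input initially occupies the registers, so it is first moved up: cell j
   goes to cell j + 20 + len, where len is the input length. *)
Fixpoint save_registers (js : seq nat) (c : cmd) : cmd :=
  if js is j :: js' then
    block [:: Const 2 (20 + j); Plus 2 2 0; Store 2 j] (save_registers js' c)
  else c.
Arguments save_registers : simpl never.

(** Cells from 20 on are moved by the loop, with source pointer 3, target pointer 4 and counter 5;
    the truncated [len - 19] is zero for short inputs. *)
Definition copy_input : cmd :=
  save_registers (iota 1 19)
    (block [:: Const 1 1; Const 3 20; Const 4 40; Plus 4 4 0; Const 2 19; Minus 5 0 2]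
    (Loop 5 (block [:: Fetch 2 3; Store 4 2; Plus 3 3 1; Plus 4 4 1; Minus 5 5 1]
       Skip))).

(** In the absence of multiplication, [n * n] is obtained as [(len - n - 4)./2], because the input
    length is [4 + n + (n * n + n * n)]. The loop quadruples register 3 [k] times, giving the number
    of masks. *)
Definition setup : cmd :=
  block [:: Const 2 21; Plus 2 2 0; Fetch 10 2; Plus 2 2 1; Plus 2 2 1; Fetch 7 2]
    (block [:: Plus 2 2 1; Fetch 11 2; Plus 12 2 1; Minus 18 0 10; Const 2 4]
      (block [:: Minus 18 18 2; Half 18 18; Plus 19 12 10; Plus 19 19 18]
        (block [:: Plus 14 19 18; Const 3 1; Const 4 0; Const 0 0]
          (Loop 7 (block [:: Plus 3 3 3; Plus 3 3 3; Minus 7 7 1] Skip))))).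

(* Register 4 holds the number of the current mask, which serves as its mark:
   thus marks need not be erased before the next mask is tried.  Register 6
   counts the marked vertices, 5 holds the unread bits of the mask, and 8 and 9
   hold the current pair of vertices, whose matrix entry has its address in 13. *)
Definition mark : cmd :=
  block [:: Fetch 2 17; Minus 2 4 2]
    (Cond 2 (block [:: Store 17 4; Plus 6 6 1] Skip) Skip).

(** The lowest bit of a mask [y] is [y - y./2 - y./2]. *)
Definition choose : cmd :=
  block [:: Half 15 5; Minus 2 5 15; Minus 2 2 15; Half 5 5]
    (Seq (Cond 2 (block [:: Plus 17 14 8] Skip) (block [:: Plus 17 14 9] Skip))
         mark).

(** The sum of the two truncated differences is the distance of the two colors, zero exactly when
    they agree. *)
Definition test_pair : cmd :=
  block [:: Plus 15 12 8; Fetch 15 15; Plus 16 12 9; Fetch 16 16;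
            Minus 2 15 16; Minus 16 16 15; Plus 2 2 16]
    (Cond 2 Skip choose).

Definition next_pair : cmd :=
  block [:: Plus 13 13 1; Plus 9 9 1; Minus 2 10 9]
    (Cond 2 Skip (block [:: Const 9 0; Plus 8 8 1] Skip)).

Definition treat_pair : cmd :=
  block [:: Minus 7 7 1; Fetch 2 13] (Seq (Cond 2 test_pair Skip) next_pair).

(** Register 3 counts the masks left and, once decremented, is itself the mask to try. The truncated
    difference of registers 6 and 11 is zero exactly when at most [r] vertices are marked. *)
Definition try_mask : cmd :=
  block [:: Minus 3 3 1; Plus 4 4 1; Const 2 0; Plus 5 3 2; Const 6 0;
            Plus 7 18 2; Const 8 0; Const 9 0; Plus 13 19 2]
    (Seq (Loop 7 treat_pair)
         (block [:: Minus 2 6 11] (Cond 2 Skip (block [:: Const 0 1] Skip)))).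

Definition dgc_cmd : cmd := Seq copy_input (Seq setup (Loop 3 try_mask)).

(** * Correctness and running time of the program *)

Section Correctness.

Variables (X : memory) (n k r : nat).
Hypothesis X0 : X 0 = 4 + n + (n * n + n * n).
Hypothesis X1 : X 1 = n.
Hypothesis X3 : X 3 = k.
Hypothesis X4 : X 4 = r.
Hypothesis X_out : forall i, X 0 < i -> X i = 0.

Definition len := X 0.
Definition color_base := 25 + len.
Definition adj_base := color_base + n + n * n.
Definition mark_base := adj_base + n * n.

(** An ordered pair of vertices is represented by its position in a row-major adjacency matrix. *)
Definition pair_src q := q %/ n.
Definition pair_tgt q := q %% n.
(** The colors begin at cell 5, after the length and four parameters, and the matrix of G' at cell
    [5 + n + n * n]. *)
Definition conflicting q := (X (5 + n + n * n + q) != 0) && (X (5 + pair_src q) == X (5 + pair_tgt q)).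

(** Cell 2 is excepted: register 2 holds the target addresses during the saving, so its input is
    overwritten before it can be copied. *)
Definition stored (h : memory) : Prop :=
  forall j, 0 < j <= len -> j <> 2 -> h (20 + len + j) = X j.

(** Vertices outside [A] may carry marks of earlier masks, which are smaller than [S]. *)
Definition marked (h : memory) (S : nat) (A : seq nat) : Prop :=
  forall w, w < n -> if w \in A then h (mark_base + w) = S else h (mark_base + w) < S.

(** Induction on the number [d] of registers still to be saved. All targets lie beyond cell
    [20 + len], so the input from cell 20 on stays intact. *)
Lemma save_registers_ok d c t Q rs h :
  d < 20 -> size rs = 20 ->
  (forall i, i < 20 -> i <> 2 -> nth 0 rs i = X i) ->
  (forall a, 20 <= a <= 20 + len -> h a = X a) ->
  (forall j, 0 < j < 20 - d -> j <> 2 -> h (20 + len + j) = X j) ->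
  (forall j, 20 <= j -> h (20 + len + j) = 0) ->
  (forall rs h, size rs = 20 ->
    (forall i, i < 20 -> i <> 2 -> nth 0 rs i = X i) ->
    (forall a, 20 <= a <= 20 + len -> h a = X a) ->
    (forall j, 0 < j < 20 -> j <> 2 -> h (20 + len + j) = X j) ->
    (forall j, 20 <= j -> h (20 + len + j) = 0) ->
    texec c rs h t Q) ->
  texec (save_registers (iota (20 - d) d) c) rs h (d * 3 + t) Q.
Proof.
move=> d20 s20 rsE srcE low high post.
elim: d d20 rs h s20 rsE srcE low high => [|d IH] d20 rs h s20 rsE srcE low high.
  by apply: post.
rewrite /= /save_registers -/save_registers.
apply: (texec_block (t := d * 3 + t)) => /=; last lia.
  by rewrite !nth_set_nth /=; lia.
rewrite set_set_nth eqxx !nth_set_nth /= rsE // -/len.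
have -> : iota (20 - d.+1).+1 d = iota (20 - d) d by congr iota; lia.
have aE : 20 + (20 - d.+1) + len = 20 + len + (20 - d.+1) by lia.
apply: IH; rewrite ?aE.
- by lia.
- by rewrite size_set_nth s20.
- by move=> i i20 i2; rewrite nth_set_nth /=; case: eqP => // _; apply: rsE.
- by move=> a al; rewrite /update; case: eqP => [|_]; [lia | apply: srcE].
- move=> j jd j2; rewrite /update; case: eqP => [/eqP|ne].
    by rewrite eqn_add2l => /eqP <-; case: eqP => // _; apply: rsE; lia.
  by apply: low => //; lia.
by move=> j j20; rewrite /update; case: eqP => [|_]; [lia | apply: high].
Qed.

(** The last clause also covers [j > len], where both sides vanish; this later provides a cleared
    mark area. *)
Lemma copy_input_ok :
  texec copy_input (mkseq X 20) X (19 * 3 + (6 + ((len - 19) * 7 + 1))) (fun rs h =>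
    (exists z2 z3 z4 z5, rs = [:: len, 1, z2, z3, z4, z5 & drop 6 (mkseq X 20)]) /\
    forall j, 0 < j -> j <> 2 -> h (20 + len + j) = X j).
Proof.
pose Inv c rs (h : memory) :=
  [/\ exists z2, rs = [:: len, 1, z2, 20 + c, 40 + len + c, len - 19 - c
                       & drop 6 (mkseq X 20)],
      forall a, 20 <= a <= 20 + len -> h a = X a,
      forall j, 0 < j < 20 + c -> j <> 2 -> h (20 + len + j) = X j
    & forall j, 20 + c <= j -> h (20 + len + j) = 0].
apply: (save_registers_ok (d := 19)) => //.
- by move=> i i20 _; rewrite nth_mkseq.
- by move=> j; lia.
- by move=> j j20; apply: X_out; rewrite -/len; lia.
move=> rs h s20 rsE srcE low high.
(* With the list in explicit form, the block that follows can be computed; only register 2 is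
   unknown. *)
have -> : rs = [:: X 0, X 1, nth 0 rs 2 & drop 3 (mkseq X 20)].
  apply: (@eq_from_nth _ 0) => // i; rewrite s20 => i20.
  case: (eqVneq i 2) => [-> //|/eqP i2]; rewrite rsE //.
  by do 20 (case: i i20 i2 => [|i] i20 i2 //).
apply: (texec_block (t := (len - 19) * (5 + 2) + 1)) => //=.
have E := @texec_loop 5 (block [:: Fetch 2 3; Store 4 2; Plus 3 3 1; Plus 4 4 1;
  Minus 5 5 1] Skip) 5 Inv (len - 19).
apply: texec_weaken (E _ _ _ _ _ _) (leqnn _) _ => //.
- move=> c rs' h' cN [[z2 ->] src_ok low' high']; split=> /=; first lia.
  apply: (texec_block (t := 0)) => //=.
  apply: texec_skip; split.
  + by exists (h' (20 + c)); congr [:: _, _, _, _, _, _ & _]; lia.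
  + by move=> a al; rewrite /update; case: eqP; [lia | rewrite src_ok].
  + move=> j jc j2; rewrite /update; case: eqP => [E'|ne].
      by rewrite src_ok; [congr X; lia | lia].
    by apply: low'; lia.
  + by move=> j jc; rewrite /update; case: eqP => [|_]; [lia | apply: high'; lia].
- by move=> ? ? [[z2 ->]] /=; rewrite subnn.
- split; rewrite ?addn0 //.
  by exists 19; rewrite subn0.
move=> ? h' [[z2 ->] _ low' high']; split; first by do 4!eexists.
move=> j j0 j2; case: (ltnP j (20 + (len - 19))) => jl; first by apply: low'; lia.
by rewrite high' // X_out // -/len; lia.
Qed.

(** The register file of the main loop: [T] masks and [rem] pairs are left, [S] is the current mark,
    [y] the unread mask bits, and [z2], [z15], [z16], [z17] are scratch values. *)
Definition frame ans T S y cnt rem u v ptr z2 z15 z16 z17 : seq nat :=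
  [:: ans; 1; z2; T; S; y; cnt; rem; u; v; n; r; color_base; ptr; mark_base; z15; z16; z17;
      n * n; adj_base].

Lemma setup_ok h z2 z3 z4 z5 :
  (forall j, 0 < j -> j <> 2 -> h (20 + len + j) = X j) ->
  texec setup [:: len, 1, z2, z3, z4, z5 & drop 6 (mkseq X 20)] h
    (19 + (k * 5 + 1)) (fun rs h' => h' = h /\
      exists y cnt u v ptr z2 z15 z16 z17,
        rs = frame 0 (2 ^ (k + k)) 0 y cnt 0 u v ptr z2 z15 z16 z17).
Proof.
move=> hX; apply: (texec_block (t := 13 + (k * (3 + 2) + 1))) => //=.
apply: (texec_block (t := 8 + (k * (3 + 2) + 1))) => //=.
apply: (texec_block (t := 4 + (k * (3 + 2) + 1))) => //=.
apply: (texec_block (t := k * (3 + 2) + 1)) => //=.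
have nnE : (len - n - 4)./2 = n * n.
  by have -> : len - n - 4 = (n * n).*2; [rewrite /len X0; lia | rewrite doubleK].
have -> : h (21 + len) = n by rewrite -X1 -hX //; congr h; lia.
have -> : h (21 + len + 1 + 1) = k by rewrite -X3 -hX //; congr h; lia.
have -> : h (21 + len + 1 + 1 + 1) = r by rewrite -X4 -hX //; congr h; lia.
have -> : 21 + len + 1 + 1 + 1 + 1 = color_base by rewrite /color_base; lia.
rewrite nnE -/adj_base -/mark_base.
pose Inv c rs h' := h' = h /\ exists y cnt u v ptr z2 z15 z16 z17,
  rs = frame 0 (2 ^ (c + c)) 0 y cnt (k - c) u v ptr z2 z15 z16 z17.
have E := @texec_loop 7 (block [:: Plus 3 3 3; Plus 3 3 3; Minus 7 7 1] Skip) 3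
  Inv k.
apply: texec_weaken (E _ _ _ _ _ _) (leqnn _) _ => //.
- move=> c rs h' ck [-> [y [cnt [u [v [ptr [y2 [z15 [z16 [z17 ->]]]]]]]]]].
  split=> /=; first lia.
  apply: (texec_block (t := 0)) => //=; apply: texec_skip; split=> //.
  exists y, cnt, u, v, ptr, y2, z15, z16, z17.
  have -> : 2 ^ (c.+1 + c.+1) = 2 ^ (c + c) + 2 ^ (c + c) + (2 ^ (c + c) + 2 ^ (c + c)).
    by rewrite addSn addnS !expnS; lia.
  by rewrite subn1 subnS.
- by move=> rs h' [_ [y [cnt [u [v [ptr [y2 [z15 [z16 [z17 ->]]]]]]]]]] /=; rewrite subnn.
- split=> //; do 9!eexists; rewrite subn0; reflexivity.
by move=> rs h'; rewrite /Inv subnn.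
Qed.

(** The mark area starts at [21 + len + len], just past the copied input, so marking preserves
    [stored]. Subtracting the old mark of [w] from [S] gives zero exactly when [w] is in [A]. *)
Lemma mark_ok ans T S y A u v rem ptr z2 z15 z16 w h :
  stored h -> marked h S A -> w < n ->
  texec mark (frame ans T S y (size A) rem u v ptr z2 z15 z16 (mark_base + w)) h 6
    (fun rs h' => let A' := if w \in A then A else w :: A in
      [/\ stored h', marked h' S A' & exists z2 z15 z16 z17,
      rs = frame ans T S y (size A') rem u v ptr z2 z15 z16 z17]).
Proof.
move=> hX hA wn; have MBE : mark_base = 21 + len + len by rewrite /mark_base /adj_base /color_base /len X0; lia.
apply: (texec_block (t := 4)) => //=.
have hw := hA _ wn.
apply: (texec_cond (t := 2)) => //= cond.
  apply: (texec_block (t := 0)) => //=.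
  apply: texec_skip; move: hw; case: (w \in A) => hw; first lia.
  split.
  - by move=> j jl j2; rewrite /update; case: eqP => [|_]; [lia | apply: hX].
  - move=> w' w'n; rewrite inE /update eqn_add2l; case: eqP => //= _.
    exact: hA.
  - by do 4!eexists; rewrite addn1.
apply: texec_weaken (texec_skip _) _ (fun _ _ q => q) => //.
move: hw; case: (w \in A) => hw; last lia.
by split=> //; do 4!eexists.
Qed.

Lemma choose_ok ans T S y A u v rem ptr z2 z15 z16 z17 h :
  stored h -> marked h S A -> u < n -> v < n ->
  texec choose (frame ans T S y (size A) rem u v ptr z2 z15 z16 z17) h 13
    (fun rs h' => let w := if odd y then u else v in
      let A' := if w \in A then A else w :: A in
      [/\ stored h', marked h' S A' & exists z2 z15 z16 z17,
      rs = frame ans T S y./2 (size A') rem u v ptr z2 z15 z16 z17]).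
Proof.
move=> hX hA un vn; apply: (texec_block (t := 3 + 6)) => //=.
have -> : y - y./2 - y./2 = odd y by have := odd_double_half y; lia.
pose w := if odd y then u else v.
pose R rs h' := rs = frame ans T S y./2 (size A) rem u v ptr (odd y) y./2 z16 (mark_base + w)
  /\ h' = h.
apply: (texec_seq (R := R)) => [|rs' h' [-> ->]]; last first.
  by apply: mark_ok => //; rewrite /w; case: ifP.
apply: (texec_cond (t := 1)) => //= cond;
  apply: (texec_block (t := 0)) => //=; apply: texec_skip; split=> //.
  by rewrite /w; case: (odd y) cond.
by rewrite /w; case: (odd y) cond.
Qed.

Lemma test_pair_ok ans T S y A rem ptr z2 z15 z16 z17 h q :
  stored h -> marked h S A -> q < n * n -> X (5 + n + n * n + q) != 0 ->
  texec test_pair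
    (frame ans T S y (size A) rem (pair_src q) (pair_tgt q) ptr z2 z15 z16 z17) h 22
    (fun rs h' => let s := scan_step conflicting pair_src pair_tgt (y, A) q in
      [/\ stored h', marked h' S s.2 & exists z2 z15 z16 z17,
      rs = frame ans T S s.1 (size s.2) rem (pair_src q) (pair_tgt q) ptr z2 z15 z16 z17]).
Proof.
move=> hX hA qn aq; have n0 : 0 < n by case: (n) qn.
have un : pair_src q < n by rewrite ltn_divLR.
have vn : pair_tgt q < n by rewrite ltn_mod.
have lE : len = 4 + n + (n * n + n * n) by [].
apply: (texec_block (t := 15)) => //=.
have hC w : w < n -> h (color_base + w) = X (5 + w).
  by move=> wn; rewrite -hX; [congr h; rewrite /color_base; lia | lia | lia].
rewrite !hC //; apply: (texec_cond (t := 13)) => //= cond; last first.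
  have eq : conflicting q by rewrite /conflicting aq /=; apply/eqP; lia.
  rewrite /scan_step eq; exact: choose_ok.
have eq : conflicting q = false by rewrite /conflicting aq /=; apply/eqP; lia.
apply: texec_weaken (texec_skip _) (leq0n _) (fun _ _ p => p).
by rewrite /scan_step eq; split=> //; do 4!eexists.
Qed.

Lemma next_pair_ok ans T S y cnt rem q ptr z2 z15 z16 z17 h : q < n * n ->
  texec next_pair
    (frame ans T S y cnt rem (pair_src q) (pair_tgt q) ptr z2 z15 z16 z17) h 7
    (fun rs h' => h' = h /\ exists z2 z15 z16 z17,
      rs = frame ans T S y cnt rem (pair_src q.+1) (pair_tgt q.+1) ptr.+1 z2 z15 z16 z17).
Proof.
move=> qn; have n0 : 0 < n by case: (n) qn.
have vn : pair_tgt q < n by rewrite ltn_mod.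
(* The column counter wraps exactly when [n] divides [q.+1], which matches the register test with
   the successor rules for quotient and remainder. *)
have nextE : (n %| q.+1) = (n - (pair_tgt q + 1) == 0).
  rewrite /dvdn -addn1 -modnDml -/(pair_tgt q); apply/eqP/eqP => [|c].
    by case: (ltnP (pair_tgt q + 1) n) => [/modn_small|]; lia.
  by rewrite (_ : pair_tgt q + 1 = n) ?modnn //; lia.
apply: (texec_block (t := 4)) => //=; apply: (texec_cond (t := 2)) => //= cond.
  apply: texec_weaken (texec_skip _) _ (fun _ _ p => p) => //; split=> //.
  rewrite /pair_src /pair_tgt divnS // modnS nextE; case: eqP => // _.
  by do 4!eexists; rewrite add0n !addn1.
apply: (texec_block (t := 0)) => //=; apply: texec_skip; split=> //.
rewrite /pair_src /pair_tgt divnS // modnS nextE -/(pair_tgt q) cond /=.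
by do 4!eexists; rewrite add1n !addn1.
Qed.

Lemma treat_pair_ok ans T S y A rem q z2 z15 z16 z17 h :
  stored h -> marked h S A -> q < n * n ->
  texec treat_pair
    (frame ans T S y (size A) rem (pair_src q) (pair_tgt q) (adj_base + q) z2 z15 z16 z17) h 33
    (fun rs h' => let s := scan_step conflicting pair_src pair_tgt (y, A) q in
      [/\ stored h', marked h' S s.2 & exists z2 z15 z16 z17,
      rs = frame ans T S s.1 (size s.2) (rem - 1) (pair_src q.+1) (pair_tgt q.+1)
             (adj_base + q.+1) z2 z15 z16 z17]).
Proof.
move=> hX hA qn; have lE : len = 4 + n + (n * n + n * n) by [].
apply: (texec_block (t := 24 + 7)) => //=.
have -> : h (adj_base + q) = X (5 + n + n * n + q).
  by rewrite -hX; [congr h; rewrite /adj_base /color_base; lia | lia | lia].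
pose R rs h' := let s := scan_step conflicting pair_src pair_tgt (y, A) q in
  [/\ stored h', marked h' S s.2 & exists z2 z15 z16 z17,
      rs = frame ans T S s.1 (size s.2) (rem - 1) (pair_src q) (pair_tgt q)
             (adj_base + q) z2 z15 z16 z17].
apply: (texec_seq (R := R)) => [|rs h' [hX' hA' [y2 [y15 [y16 [y17 ->]]]]]].
  apply: (texec_cond (t := 22)) => //= cond.
    by apply: test_pair_ok => //; apply/eqP.
  have eq : conflicting q = false by rewrite /conflicting cond.
  apply: texec_weaken (texec_skip _) (leq0n _) (fun _ _ p => p).
  by rewrite /R /scan_step eq; split=> //; do 4!eexists.
apply: texec_weaken (next_pair_ok qn) (leqnn _) _.
move=> rs' h'' [-> [x2 [x15 [x16 [x17 ->]]]]]; split=> //.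
by exists x2, x15, x16, x17; rewrite addnS.
Qed.

Definition good_mask y := size (scan conflicting pair_src pair_tgt y (iota 0 (n * n))) <= r.

Lemma try_mask_ok (ans : bool) T S y cnt rem u v ptr z2 z15 z16 z17 h :
  stored h -> marked h S.+1 [::] ->
  texec try_mask (frame ans T S y cnt rem u v ptr z2 z15 z16 z17) h
    (9 + ((n * n * 35 + 1) + 4))
    (fun rs h' => [/\ stored h', marked h' S.+2 [::] &
      exists y cnt rem u v ptr z2 z15 z16 z17,
      rs = frame (ans || good_mask T.-1) T.-1 S.+1 y cnt rem u v ptr z2 z15 z16 z17]).
Proof.
move=> hX hA; apply: (texec_block (t := (n * n * 35 + 1) + 4)) => //=.
pose st p := foldl (scan_step conflicting pair_src pair_tgt) (T.-1, [::]) (iota 0 p).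
have stS p : st p.+1 = scan_step conflicting pair_src pair_tgt (st p) p.
  by rewrite /st -addn1 iotaD add0n cats1 foldl_rcons.
pose Inv p rs h' := [/\ stored h', marked h' S.+1 (st p).2 &
  exists z2 z15 z16 z17, rs = frame ans T.-1 S.+1 (st p).1 (size (st p).2)
    (n * n - p) (pair_src p) (pair_tgt p) (adj_base + p) z2 z15 z16 z17].
apply: (texec_seq (R := Inv (n * n))) => [|rs h' [hX' hA']].
  apply: (texec_loop (t := 33)) => //.
  - move=> p rs h' pn [hX' hA' [y2 [y15 [y16 [y17 ->]]]]]; split=> /=; first lia.
    apply: texec_weaken (treat_pair_ok hX' hA' pn) (leqnn _) _.
    move=> rs' h'' [hX'' hA'' [x2 [x15 [x16 [x17 ->]]]]].
    rewrite /Inv stS [st p]surjective_pairing.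
    by split=> //; exists x2, x15, x16, x17; rewrite subn1 subnS.
  - by move=> rs h' [_ _ [y2 [y15 [y16 [y17 ->]]]]] /=; rewrite subnn.
  - split=> //; do 4!eexists.
    by rewrite /frame /pair_src /pair_tgt div0n mod0n subn1 addn1 !addn0 subn0.
case=> [y2 [y15 [y16 [y17 ->]]]].
(* All marks are at most [S.+1], hence below the next mark number: incrementing it empties the
   marked set. *)
have hM : marked h' S.+2 [::].
  by move=> w /hA'; case: (_ \in _) => /= hw; lia.
have gE : good_mask T.-1 = (size (st (n * n)).2 - r == 0) by rewrite subn_eq0.
apply: (texec_block (t := 3)) => //=; apply: (texec_cond (t := 1)) => //= cond.
  apply: texec_weaken (texec_skip _) (leq0n _) (fun _ _ p => p); split=> //.
  rewrite gE; case: eqP => // _; rewrite orbF.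
  by do 10!eexists.
apply: (texec_block (t := 0)) => //=; apply: texec_skip; split=> //.
by rewrite gE cond orbT; do 10!eexists.
Qed.

Lemma dgc_cmd_ok : exists t m,
  [/\ t <= 100 + len * 7 + k * 5 + 2 ^ (k + k) * (n * n * 35 + 16),
      run dgc_cmd X t m
    & m 0 = has good_mask (iota 0 (2 ^ (k + k)))].
Proof.
pose N := 2 ^ (k + k).
have lE : len = 4 + n + (n * n + n * n) by [].
have MBE : mark_base = 21 + len + len by rewrite /mark_base /adj_base /color_base /len X0; lia.
(* Masks are tried downwards, so after [j] rounds those from [N - j] to [N - 1] have been tested. *)
pose Inv j rs h := [/\ stored h, marked h j.+1 [::] &
  exists y cnt rem u v ptr z2 z15 z16 z17,
  rs = frame (has good_mask (iota (N - j) j)) (N - j) j y cnt rem u v ptr z2 z15 z16 z17].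
have E : texec dgc_cmd (mkseq X 20) X
  ((19 * 3 + (6 + ((len - 19) * 7 + 1))) + ((19 + (k * 5 + 1)) +
   (N * (9 + ((n * n * 35 + 1) + 4) + 2) + 1))) (Inv N).
  apply: texec_seq copy_input_ok _ => rs h [[z2 [z3 [z4 [z5 ->]]]] hX].
  apply: texec_seq (setup_ok hX) _ => {}rs h0.
  case=> [{h0}-> [y [cnt [u [v [ptr [y2 [y15 [y16 [y17 ->]]]]]]]]]].
  apply: texec_loop => //.
  - move=> j rs' h' jN [hX' hA'].
    case=> [x [x0 [x1 [x3 [x4 [x5 [x6 [x7 [x8 [x9 ->]]]]]]]]]].
    split=> /=; first lia.
    apply: texec_weaken (try_mask_ok hX' hA') (leqnn _) _.
    move=> rs'' h'' [hX'' hA'' [w [w0 [w1 [w3 [w4 [w5 [w6 [w7 [w8 [w9 ->]]]]]]]]]]].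
    split=> //; exists w, w0, w1, w3, w4, w5, w6, w7, w8, w9.
    rewrite -subnS /= subnSK // orbC.
    by [].
  - move=> rs' h' [_ _].
    by case=> [x [x0 [x1 [x3 [x4 [x5 [x6 [x7 [x8 [x9 ->]]]]]]]]]] /=; rewrite subnn.
  split.
  - by move=> i il i2; apply: hX; lia.
  (* Initially all marks are zero, hence below the first mark number 1. *)
  - move=> w wn /=; have -> : mark_base + w = 20 + len + (len + 1 + w) by lia.
    by rewrite hX; [rewrite X_out // -/len; lia | lia | lia].
  - by do 10!eexists; rewrite /= subn0.
have [t [m [rs [h [tle mrun v [_ _ inv]]]]]] := E _ (view_id X).
exists t, m; split=> //; first by apply: leq_trans tle _; rewrite -/N; lia.
case: inv => [x [x0 [x1 [x3 [x4 [x5 [x6 [x7 [x8 [x9 rsE]]]]]]]]]].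
by rewrite v.2 rsE /= subnn.
Qed.

End Correctness.

(** * Conflicts and recolorings *)

Lemma nth_allpairs (S T U : Type) (f : S -> T -> U) x0 y0 z0 s t i j :
  i < size s -> j < size t ->
  nth z0 [seq f x y | x <- s, y <- t] (i * size t + j) =
    f (nth x0 s i) (nth y0 t j).
Proof.
elim: s i => // x s IH [|i] /= si tj; rewrite nth_cat size_map.
  by rewrite mul0n add0n tj (nth_map y0).
rewrite mulSn -addnA ltnNge leq_addr /= addKn.
exact: IH.
Qed.

Lemma set2_inj (T : finType) (a b c d : T) :
  [set a; b] = [set c; d] -> a = c /\ b = d \/ a = d /\ b = c.
Proof.
move=> E; have /set2P a_in : a \in [set c; d] by rewrite -E set21.
have /set2P b_in : b \in [set c; d] by rewrite -E set22.
have /set2P c_in : c \in [set a; b] by rewrite E set21.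
have /set2P d_in : d \in [set a; b] by rewrite E set22.
by case: a_in b_in c_in d_in => [-> | ->] [-> | ->] [] ? [] ?; auto.
Qed.

Lemma in_edges n (G : sgraph n) u v : ([set u; v] \in edges G) = adj G u v.
Proof.
rewrite inE; apply/existsP/idP => [[a /existsP[b /andP[ab /eqP/set2_inj]]]|uv].
  by case=> [[-> ->] //|[-> ->]]; rewrite adj_sym.
by exists u; apply/existsP; exists v; rewrite uv eqxx.
Qed.

Section Instance.

Variable I : dgc_instance.
Let n := nvertices I.
Let C := @col I.
Let X := nth 0 (size (dgc_encode I) :: dgc_encode I).
Let edge := conflicting X n.

Definition conflict (u v : 'I_n) : bool := adj (graph' I) u v && (C u == C v).

(** A conflicting pair is determined by its edge and its orientation. The edge lies in G' but not in
    G, on which [C] is proper; the orientation accounts for the factor two. *)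
Lemma card_conflict :
  #|[set p : 'I_n * 'I_n | conflict p.1 p.2]| <= edit I + edit I.
Proof.
pose g (p : 'I_n * 'I_n) := ([set p.1; p.2], p.1 < p.2).
pose D := edges (graph' I) :\: edges (graph I).
have g_inj : {in [set p : 'I_n * 'I_n | conflict p.1 p.2] &, injective g}.
  move=> [u v] [u' v'] /=; rewrite !inE /= => /andP[uv _] _ [/set2_inj].
  case=> [[-> ->] //|[uE vE]] lt_uv.
  have : u != v by apply: contraTneq uv => ->; rewrite adj_irr.
  by rewrite -val_eqE /= uE vE in lt_uv *; lia.
rewrite -(card_in_imset g_inj).
apply: leq_trans (subset_leq_card (B := setX D setT) _) _.
  apply/subsetP => _ /imsetP[[u v] + ->]; rewrite inE => /andP[/= uv /eqP Cuv].
  rewrite in_setX in_setT andbT in_setD !in_edges uv andbT.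
  have [_ proper] := col_ok I.
  by apply/negP => /proper; rewrite -/(C u) Cuv eqxx.
rewrite cardsX cardsT card_bool muln2 addnn leq_double.
apply: leq_trans (edit_ok I).
by rewrite /edit_distance leq_addl.
Qed.

Lemma encode_length : X 0 = 4 + n + (n * n + n * n).
Proof.
by rewrite /X /= size_cat size_map !size_cat !size_allpairs !size_enum_ord.
Qed.

Lemma encode_color (u : 'I_n) : X (5 + u) = C u.
Proof.
rewrite /X /= add0n nth_cat size_map size_enum_ord ltn_ord.
by rewrite (nth_map u) ?size_enum_ord // nth_ord_enum.
Qed.

Lemma encode_adj (u v : 'I_n) : X (5 + n + n * n + (u * n + v)) = adj (graph' I) u v.
Proof.
have -> : 5 + n + n * n + (u * n + v) = 5 + (n + (n * n + (u * n + v))) by lia.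
rewrite /X /= add0n nth_cat size_map size_enum_ord ltnNge leq_addr /= addKn.
rewrite nth_cat size_allpairs size_enum_ord ltnNge leq_addr /= addKn.
have := @nth_allpairs _ _ _ (fun a b => nat_of_bool (adj (graph' I) a b)) u v 0
  (enum 'I_n) (enum 'I_n) u v.
by rewrite size_enum_ord !nth_ord_enum; apply.
Qed.

Lemma pair_code_lt (u v : 'I_n) : u * n + v < n * n.
Proof. by have := ltn_ord u; have := ltn_ord v; nia. Qed.

Lemma pair_codeK (u v : 'I_n) :
  pair_src n (u * n + v) = u /\ pair_tgt n (u * n + v) = v.
Proof.
have n0 : 0 < n by apply: leq_ltn_trans (ltn_ord u).
by rewrite /pair_src /pair_tgt divnMDl // divn_small // addn0 modnMDl modn_small.
Qed.

Lemma pair_codeP q : q < n * n -> exists u v : 'I_n, q = u * n + v.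
Proof.
move=> qn; have n0 : 0 < n by case: (n) qn.
have un : q %/ n < n by rewrite ltn_divLR.
by exists (Ordinal un), (Ordinal (ltn_pmod q n0)); apply: divn_eq.
Qed.

Lemma conflictingE (u v : 'I_n) : edge (u * n + v) = conflict u v.
Proof.
have [uE vE] := pair_codeK u v.
by rewrite /edge /conflicting uE vE encode_adj !encode_color /conflict; case: (adj _ u v).
Qed.

(** Every conflicting matrix position is the code of a conflicting pair, so the bound on pairs
    carries over. *)
Lemma count_conflicting : count edge (iota 0 (n * n)) <= edit I + edit I.
Proof.
apply: leq_trans card_conflict; rewrite cardE -size_filter.
rewrite -(size_map (fun p : 'I_n * 'I_n => p.1 * n + p.2)).
apply: uniq_leq_size => [|q]; first by rewrite filter_uniq ?iota_uniq.
rewrite mem_filter mem_iota => /andP[+ /pair_codeP[u [v qE]]].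
rewrite qE conflictingE => uv; apply/mapP; exists (u, v) => //.
by rewrite mem_enum inE.
Qed.

(** The position of a vertex in [A] determines its fresh color, so fresh colors are pairwise
    distinct and at most [ncolors I + incr I]. *)
Lemma recolor (A : seq nat) :
  (forall u v : 'I_n, conflict u v -> (val u \in A) || (val v \in A)) ->
  uniq A -> size A <= incr I -> dgc_yes I.
Proof.
move=> cov uA sA; have [range proper] := col_ok I.
pose fresh (v : 'I_n) := ncolors I + (index (val v) A).+1.
exists (fun v => if val v \in A then fresh v else C v); split; first split.
- move=> v; case: ifP => [vA|_].
    by rewrite /fresh addnS ltnS leq0n -addnS leq_add2l (leq_trans _ sA) // index_mem.
  by have := range v; rewrite /C; lia.
- move=> u v uv; have ru := range u; have rv := range v.
  case: ifPn => uA'; case: ifPn => vA'; rewrite /fresh /C.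
  + apply/eqP => /addnI[] /(congr1 (nth 0 A)); rewrite !nth_index // => /val_inj E'.
    by rewrite E' adj_irr in uv.
  + by lia.
  + by lia.
  (* If two adjacent vertices kept equal colors, they would conflict and [cov] would put one of them
     in [A]. *)
  + apply: contraNneq uA' => E.
    have := cov u v; rewrite /conflict uv /C E eqxx => /(_ isT).
    by rewrite (negbTE vA') orbF.
apply: leq_trans sA; rewrite /hamming cardE -(size_map val).
apply: uniq_leq_size; first by rewrite map_inj_uniq ?enum_uniq //; apply: val_inj.
move=> _ /mapP[v + ->]; rewrite mem_enum inE.
by case: ifP => //; rewrite eqxx.
Qed.

Lemma recolored_cover (C' : 'I_n -> nat) c u v :
  is_coloring (graph' I) c C' -> conflict u v ->
  (C u != C' u) || (C v != C' v).
Proof.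
move=> [_ proper] /andP[/proper uv /eqP Cuv].
by rewrite -negb_and; apply: contra uv => /andP[/eqP <- /eqP <-]; rewrite Cuv.
Qed.

Lemma good_maskP :
  reflect (dgc_yes I)
    (has (good_mask X n (incr I)) (iota 0 (2 ^ (edit I + edit I)))).
Proof.
apply: (iffP hasP) => [[y _ sA]|[C' [colC' ham]]].
  apply: (recolor _ (scan_uniq _ _ _ y _) sA) => u v uv.
  have [uE vE] := pair_codeK u v.
  have := @scan_covers edge (pair_src n) (pair_tgt n) y (iota 0 (n * n)) (u * n + v).
  by rewrite uE vE mem_iota conflictingE; apply=> //; apply: pair_code_lt.
(* The vertices recolored by the given solution form the cover that the mask is made to follow. *)
pose S w := [exists v : 'I_n, (val v == w) && (C v != C' v)].
have [|y ylt /allP SA] := @scan_complete edge (pair_src n) (pair_tgt n) S (iota 0 (n * n)).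
  move=> q; rewrite mem_iota => /pair_codeP[u [v ->]].
  rewrite conflictingE => /(recolored_cover colC').
  have [-> ->] := pair_codeK u v.
  case/orP=> ne; apply/orP; [left|right]; apply/existsP; [exists u|exists v];
  by rewrite eqxx.
exists y.
  rewrite mem_iota; apply: leq_trans ylt _.
  (* At most [edit I + edit I] bits are consumed, so the mask is within the search range. *)
  by rewrite leq_exp2l // count_conflicting.
apply: leq_trans ham; rewrite /hamming cardE -(size_map val).
apply: uniq_leq_size => [|w /SA/existsP[v /andP[/eqP <- ne]]].
  exact: scan_uniq.
by apply: map_f; rewrite mem_enum inE.
Qed.

Lemma size_encode_le : size (dgc_encode I) <= input_size (dgc_encode I).
Proof. by rewrite -sum1_size; apply: leq_sum. Qed.

(** The input size [s] is at least the input length, hence at least [n * n * 2]. Each summand is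
    then at most a constant times [2 ^ (edit I + edit I) * s ^ 2], and the factor [2 ^ 8] covers the
    sum of the constants. *)
Lemma dgc_time_le :
  100 + len X * 7 + edit I * 5 + 2 ^ (edit I + edit I) * (n * n * 35 + 16) <=
  2 ^ (edit I + edit I + 8) * input_size (dgc_encode I) ^ 2.
Proof.
set s := input_size _; have ls : len X <= s by apply: size_encode_le.
have lE : len X = 4 + n + (n * n + n * n) by apply: encode_length.
have kN : edit I < 2 ^ (edit I + edit I).
  by apply: leq_trans (ltn_expl _ (isT : 1 < 2)) _; rewrite leq_exp2l // leq_addr.
rewrite [2 ^ (_ + 8)]expnD; move: (2 ^ (edit I + edit I)) kN => N kN.
have s4 : 4 <= s by lia.
have ss : 4 * s <= s ^ 2 by rewrite expnS expn1 leq_mul2r s4 orbT.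
have nn : n * n * 2 <= s by lia.
have sN : s ^ 2 <= N * s ^ 2 by rewrite leq_pmull //; lia.
have kN' : N * 1 <= N * s ^ 2 by rewrite leq_mul2l; lia.
have nN : N * (n * n * 35 + 16) <= N * (s ^ 2 * 35) by rewrite leq_mul2l; lia.
rewrite (_ : 2 ^ 8 = 256) //; lia.
Qed.

End Instance.

Theorem theorem1 : fixed_parameter_tractable DGC_by_edit.
Proof.
(* The summand 8 and the exponent 2 are those of [dgc_time_le]. *)
exists (fun k => 2 ^ (k + k + 8)), (compile 0 dgc_cmd), 2.
split=> [|I]; first exact: computable_exp2.
have [i|t [m [tle crun mE]]] := @dgc_cmd_ok
  (nth 0 (size (dgc_encode I) :: dgc_encode I)) (nvertices I) (edit I) (incr I)
  (encode_length I) erefl erefl erefl.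
  by case: i => // i; apply: (@nth_default _ 0 (dgc_encode I) i).
eexists; split; first exact: (iff_sym (rwP (good_maskP I))).
rewrite -mE; apply: run_outputs crun _.
exact: leq_trans tle (dgc_time_le I).
Qed.
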